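(* Assume the setting and notation in the context. Suppose the scores $\{T_i\}_{i\in\mathcal C\cup\mathcal U}$ are continuous random variables and the residuals $\{R_i\}_{i\in\mathcal C\cup\mathcal U}$ are continuous random variables. Suppose the ranking threshold is test-driven: $\hat\kappa=\kappa(T_i:i\in\mathcal U)$ for a deterministic measurable $\kappa:\mathbb R^m\to\{1,\dots,m\}$. Suppose further there is a deterministic $t_u\in\mathbb R$ such that almost surely $\hat\kappa^{j\leftarrow t_u}=\hat\kappa$ for every $j\in\mathcal U$, where $\hat\kappa^{j\leftarrow t}$ denotes the value of $\kappa$ computed after replacing $T_j$ by $t$; and that $\hat\kappa\le m-1$ almost surely. Let $\hat{\mathcal S}_u=\{j\in\mathcal U:T_j\le T_{(\hat\kappa)}\}$, $\hat{\mathcal S}_c^+=\{i\in\mathcal C: T_i\le T_{(\hat\kappa+1)}\}$, and for $j\in\hat{\mathcal S}_u$ let $\mathrm{PI}_j=[\hat\mu(X_j)-Q_\alpha(\{R_i\}_{i\in\hat{\mathcal S}_c^+}),\ \hat\mu(X_j)+Q_\alpha(\{R_i\}_{i\in\hat{\mathcal S}_c^+})]$. Then $$\alpha-\mathbb E\Big[\frac{1}{(n+1)F_T(T_{(\hat\kappa+1)})}\Big]\le \mathrm{FCR}\le\alpha,$$ where $F_T$ is the common cumulative distribution function of the $T_i$.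
   Context: Setting: $\hat\mu:\mathbb R^d\to\mathbb R$ and $g:\mathbb R^d\to\mathbb R$ are fixed deterministic measurable functions. Calibration indices $\mathcal C$, $|\mathcal C|=n$; test indices $\mathcal U$ (disjoint), $|\mathcal U|=m\ge2$. The pairs $(X_i,Y_i)\in\mathbb R^d\times\mathbb R$, $i\in\mathcal C\cup\mathcal U$, are i.i.d. Scores $T_i=g(X_i)$, residuals $R_i=|Y_i-\hat\mu(X_i)|$, $\alpha\in(0,1)$. $T_{(r)}$ denotes the $r$-th smallest value of the test scores $\{T_i\}_{i\in\mathcal U}$. For a finite index set $S$, $Q_\alpha(\{R_i\}_{i\in S})$ is the $\lceil(1-\alpha)(|S|+1)\rceil$-th smallest value of $\{R_i\}_{i\in S}$, equal to $+\infty$ if that index exceeds $|S|$. $\mathrm{FCR}=\mathbb E\Big[\frac{|\{j\in\hat{\mathcal S}_u: Y_j\notin\mathrm{PI}_j\}|}{\max\{|\hat{\mathcal S}_u|,1\}}\Big]$. *)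

(* Defs.v *)
From HB Require Import structures.
From mathcomp Require Import all_boot all_order all_algebra.
From mathcomp Require Import all_classical all_reals all_analysis.
Set Implicit Arguments. Unset Strict Implicit. Unset Printing Implicit Defensive.
Import Order.TTheory GRing.Theory Num.Theory.
Local Open Scope classical_set_scope.
Local Open Scope ring_scope.

Section Defs.
Context {R : realType}.

Definition ostat (s : seq R) (r : nat) : R := nth 0 (sort <=%O s) r.-1.

Definition qalpha (alpha : R) (s : seq R) : \bar R :=
  let k := `|Num.ceil ((1 - alpha) * ((size s)%:R + 1))|%N in
  if (size s < k)%N then +oo%E else (ostat s k)%:E.

Definition mutually_independent {d} {Omega : measurableType d}
  (P : probability Omega R) {I : finType} {d'} {V : measurableType d'}
  (Z : I -> Omega -> V) : Prop :=
  forall A : I -> set V, (forall i, measurable (A i)) ->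
    P (\bigcap_(i in [set: I]) (Z i @^-1` A i)) = (\prod_(i : I) P (Z i @^-1` A i))%E.

Definition identically_distributed {d} {Omega : measurableType d}
  (P : probability Omega R) {I : Type} {d'} {V : measurableType d'}
  (Z : I -> Omega -> V) : Prop :=
  forall i j (A : set V), measurable A -> P (Z i @^-1` A) = P (Z j @^-1` A).

Definition iid {d} {Omega : measurableType d}
  (P : probability Omega R) {I : finType} {d'} {V : measurableType d'}
  (Z : I -> Omega -> V) : Prop :=
  [/\ forall i, measurable_fun [set: Omega] (Z i),
      mutually_independent P Z & identically_distributed P Z].

Definition continuous_rv {d} {Omega : measurableType d}
  (P : probability Omega R) (V : Omega -> R) : Prop :=
  forall t : R, P [set w | V w = t] = 0%E.

Variables (n m dim : nat).
(* indices: inl i = calibration i in C (|C| = n), inr j = test j in U (|U| = m) *)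
Variables (Omega : Type) (X : 'I_n + 'I_m -> Omega -> dim.-tuple R)
  (Y : 'I_n + 'I_m -> Omega -> R) (muhat g : dim.-tuple R -> R)
  (kappa : m.-tuple R -> nat) (alpha : R).

Definition score i w := g (X i w).
Definition resid i w := `|Y i w - muhat (X i w)|.

Definition test_scores w : m.-tuple R := [tuple score (inr j) w | j < m].

Definition replace_at (s : m.-tuple R) (j : 'I_m) (t : R) : m.-tuple R :=
  [tuple if k == j then t else tnth s k | k < m].

Definition kappa_hat w := kappa (test_scores w).

Definition Tord w r := ostat (test_scores w) r.

Definition sel_test w : seq 'I_m :=
  [seq j <- enum 'I_m | score (inr j) w <= Tord w (kappa_hat w)].

Definition sel_calib w : seq 'I_n :=
  [seq i <- enum 'I_n | score (inl i) w <= Tord w (kappa_hat w).+1].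

Definition Qhat w : \bar R := qalpha alpha [seq resid (inl i) w | i <- sel_calib w].

Definition miscovered w (j : 'I_m) : bool :=
  ~~ (((muhat (X (inr j) w))%:E - Qhat w <= (Y (inr j) w)%:E)%E &&
      ((Y (inr j) w)%:E <= (muhat (X (inr j) w))%:E + Qhat w)%E).

Definition fcp w : R :=
  (count (miscovered w) (sel_test w))%:R / (maxn (size (sel_test w)) 1)%:R.

End Defs.

(* Main.v *)
Require Import Defs.
From HB Require Import structures.
From mathcomp Require Import all_boot all_order all_algebra.
From mathcomp Require Import all_classical all_reals all_analysis.
From mathcomp Require Import fingroup perm measurable_realfun.
From mathcomp Require Import zify lra.
Import Order.TTheory GRing.Theory Num.Theory.
Local Open Scope classical_set_scope.
Local Open Scope ring_scope.

(** Fix a test index [j].  Since [kappa] is unchanged when [T_j] is replaced by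
    [t_u], the rank and the threshold [theta_j], the [kappa]-th smallest of the
    other test scores, are functions of the test scores other than [T_j].  Index
    [j] is selected iff [T_j <= theta_j], and in that case
    [theta_j = T_(kappa+1)], so a calibration index [i] is selected iff
    [T_i <= theta_j]: the calibration points and [j] enter symmetrically.  If [N]
    of these [n+1] points lie below [theta_j], exactly
    [N - ceil ((1 - alpha) N)], a number in [(alpha N - 1, alpha N]], have a
    residual exceeding the conformal quantile of the other selected ones.  By
    exchangeability [(n+1) P(j selected and miscovered)] is the expectation of
    that number, while [E N = (n+1) P(j selected)]; dividing by [kappa] and
    summing over [j] gives the upper bound.  The loss of at most [1] in the lower
    bound is rewritten as [1 = E[1(T_j <= theta_j) / F theta_j | T_l, l <> j]]. *)

Set Implicit Arguments.
Unset Strict Implicit.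

(** * Order statistics, the conformal quantile and ranks as counts *)

(** In the sorted list the entries below [x] form an initial segment, whose length decides whether
    position [r.-1] lies in it. Every later statement on order statistics becomes a count through
    this equivalence, ties included. *)
Lemma le_ostat (R : realType) (x : R) (s : seq R) (r : nat) :
  (0 < r <= size s)%N ->
  (x <= ostat s r) = (count (fun y : R => (y < x)%R) s < r)%N.
Proof.
case: r => // r /= rs.
have sort_s : sorted <=%O (sort <=%O s) := sort_le_sorted s.
have count_s : count (fun y : R => (y < x)%R) s = count (< x) (sort <=%O s).
  by apply/seq.permP; rewrite perm_sym perm_sort.
rewrite /ostat /= count_s ltnS; case: leqP => count_r.
  by apply: nth_count_ge => //; rewrite count_r size_sort.
by apply/negbTE; rewrite -ltNge; apply: nth_count_lt.
Qed.

(** [N] counts the test point as well, so [N] stands for [size s + 1] of [qalpha]. The absolute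
    value only turns an integer into a natural number: the ceiling is nonnegative for
    [alpha < 1]. *)
Definition conf_index {R : realType} (alpha : R) (N : nat) : nat :=
  `|Num.ceil ((1 - alpha) * N%:R)|%N.

Lemma conf_index_ge (R : realType) (alpha : R) (N : nat) : alpha < 1 ->
  (1 - alpha) * N%:R <= (conf_index alpha N)%:R.
Proof.
move=> alpha1; rewrite /conf_index natr_absz ger0_norm.
  exact: ceil_ge.
by rewrite ceil_ge0 (lt_le_trans (ltrN10 _)) // mulr_ge0 // subr_ge0 ltW.
Qed.

Lemma conf_index_lt (R : realType) (alpha : R) (N : nat) : alpha < 1 ->
  (conf_index alpha N)%:R < (1 - alpha) * N%:R + 1.
Proof.
move=> alpha1; rewrite /conf_index natr_absz ger0_norm.
  by rewrite -ltrBlDr; have := ceilB1_lt ((1 - alpha) * N%:R); rewrite intrB.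
by rewrite ceil_ge0 (lt_le_trans (ltrN10 _)) // mulr_ge0 // subr_ge0 ltW.
Qed.

Lemma conf_index_gt0 (R : realType) (alpha : R) (N : nat) : alpha < 1 ->
  (0 < conf_index alpha N.+1)%N.
Proof.
move=> alpha1; rewrite -(ltr_nat R).
apply: (lt_le_trans _ (conf_index_ge N.+1 alpha1)).
by rewrite mulr_gt0 // subr_gt0.
Qed.

Lemma conf_index_le (R : realType) (alpha : R) (N : nat) : 0 < alpha < 1 ->
  (conf_index alpha N <= N)%N.
Proof.
move=> /andP[alpha0 alpha1]; rewrite -ltnS -(ltr_nat R) -natr1.
apply: (lt_le_trans (conf_index_lt N alpha1)).
by rewrite lerD2r ler_piMl // lerBlDr lerDl ltW.
Qed.

(** If the index exceeds [size s], the quantile is [+oo] and both sides are false, a count being at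
    most [size s]. Otherwise this is the negation of [le_ostat]. *)
Lemma qalpha_lt (R : realType) (alpha : R) (s : seq R) (x : R) : alpha < 1 ->
  (qalpha alpha s < x%:E)%E =
  (conf_index alpha (size s).+1 <= count (fun y : R => (y < x)%R) s)%N.
Proof.
move=> alpha1; rewrite /qalpha natr1 -/(conf_index alpha (size s).+1).
case: ltnP => [lt_s|le_s].
  by rewrite ltNge leey; apply/esym/negbTE; rewrite -ltnNge (leq_ltn_trans (count_size _ _)).
by rewrite lte_fin ltNge le_ostat ?conf_index_gt0 // -leqNgt.
Qed.

Lemma notin_symmetric_interval (R : realType) (y mu : R) (q : \bar R) :
  q != -oo%E ->
  ~~ ((mu%:E - q <= y%:E)%E && (y%:E <= mu%:E + q)%E) = (q < `|y - mu|%:E)%E.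
Proof.
case: q => [q| |] // _.
  rewrite -EFinB -EFinD !lee_fin lte_fin ltNge; congr (~~ _).
  by rewrite ler_distl.
by rewrite /= leNye leey.
Qed.

(** Injectivity makes the ranks within [A] a permutation of [0, ..., #|A| - 1], of which [#|A| - k]
    are at least [k]; truncated subtraction covers [k > #|A|]. *)
Lemma card_rank_ge (R : realType) (I : finType) (A : {pred I}) (f : I -> R)
    (k : nat) : {in A &, injective f} ->
  #|[pred a in A | k <= #|[pred b in A | (f b < f a)%R]|]%N| = (#|A| - k)%N.
Proof.
move=> finj; pose rank a := #|[pred b in A | (f b < f a)%R]|.
have rank_lt a b : a \in A -> f a < f b -> (rank a < rank b)%N.
  move=> aA fab; apply: proper_card; rewrite properE; apply/andP; split.
    apply/fintype.subsetP => c; rewrite !inE => /andP[-> /= /lt_trans]; exact.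
  by apply/fintype.subsetPn; exists a; rewrite !inE ?aA ?fab ?ltxx.
have rank_inj : {in A &, injective rank}.
  move=> a b aA bA rab; apply: finj => //.
  case: (ltgtP (f a) (f b)) => // fab; first by have := rank_lt _ _ aA fab; rewrite rab ltnn.
  by have := rank_lt _ _ bA fab; rewrite rab ltnn.
have rank_iota : perm_eq [seq rank a | a <- enum A] (iota 0 #|A|).
  have uniq_rank : uniq [seq rank a | a <- enum A].
    by rewrite map_inj_in_uniq ?enum_uniq // => a b; rewrite !mem_enum; apply: rank_inj.
  apply: uniq_perm => //; first exact: iota_uniq.
  apply: (uniq_min_size uniq_rank _ _).2.
    move=> r /mapP[a]; rewrite mem_enum => aA ->; rewrite mem_iota add0n /=.
    apply: proper_card; rewrite properE; apply/andP; split.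
      by apply/fintype.subsetP => c; rewrite !inE => /andP[].
    by apply/fintype.subsetPn; exists a; rewrite // !inE ltxx andbF.
  by rewrite size_map size_iota -cardE.
have -> : #|[pred a in A | k <= rank a]%N| = count (leq k) [seq rank a | a <- enum A].
  rewrite count_map cardE /enum_mem size_filter.
  by rewrite count_filter; apply: eq_count => a; rewrite !inE andbC.
rewrite (seq.permP rank_iota) -size_filter.
have /= := size_filter (leq k) (iota 0 #|A|).
elim: #|A| => [|N IH _] //; rewrite -addn1 iotaD filter_cat size_cat /= add0n.
rewrite IH ?size_filter //.
by case: leqP => kN /=; lia.
Qed.

Lemma card_rank_lt (R : realType) (I : finType) (f : I -> R) (k : nat) :
  injective f -> (k <= #|I|)%N ->
  #|[pred a | #|[pred b | (f b < f a)%R]| < k]%N| = k.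
Proof.
move=> finj kI.
pose low := [pred a | #|[pred b | (f b < f a)%R]| < k]%N.
have highE : #|[predC low]| = (#|I| - k)%N.
  rewrite -(@card_rank_ge R I predT f k (in2W finj)).
  by apply: eq_card => a; rewrite !inE -leqNgt.
by apply/eqP; rewrite -(eqn_add2r (#|I| - k)) -{1}highE cardC subnKC.
Qed.

(** * Measurability of order statistics and of random ranks *)

(* Ranks and counts factor through finitely many comparisons, so this reduces their
   measurability to that of the comparisons. *)
Lemma measurable_fun_finite_bools d (T : measurableType d) d' (U : measurableType d')
    (K : finType) (B : K -> T -> bool) (G : {ffun K -> bool} -> U) :
  (forall p, measurable_fun setT (B p)) ->
  measurable_fun setT (fun w => G [ffun p => B p w]).
Proof.
move=> mB _ Y mY; rewrite setTI.
rewrite [X in measurable X](_ : _ =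
    \bigcup_(b in [set b | Y (G b)]) \bigcap_(p in [set: K]) (B p @^-1` [set b p])).
  apply: fin_bigcup_measurable; first exact: finite_finset.
  move=> b _; apply: fin_bigcap_measurable; first exact: finite_finset.
  by move=> p _; rewrite -[X in measurable X]setTI; exact: mB.
apply/seteqP; split=> [w Yw|w [b Yb Bb]].
  by exists [ffun p => B p w] => // p _; rewrite /= ffunE.
rewrite /preimage /= (_ : [ffun p => B p w] = b) //.
by apply/ffunP => p; rewrite ffunE; exact: Bb.
Qed.

(** The half-lines [[x, +oo[] generate the Borel sets, and by [le_ostat] their preimages are decided
    by the comparisons of the [f l] with [x]. *)
Lemma measurable_ostat d (T : measurableType d) (R : realType) (J : finType)
    (e : seq J) (f : J -> T -> R) (r : nat) :
  (forall l, measurable_fun setT (f l)) ->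
  measurable_fun setT (fun w => ostat [seq f l w | l <- e] r).
Proof.
(* Ranks [0] and [1] give the same order statistic, because of [r.-1]. *)
move=> mf; wlog r_gt0 : r / (0 < r)%N.
  by case: r => [|r] H; [exact: (H 1%N) | exact: H].
have [r_le|r_gt] := leqP r (size e); last first.
  (* A rank beyond the length reads the default value [0] of [nth]. *)
  rewrite (_ : (fun w => _) = cst 0); first exact: measurable_cst.
  apply/funext => w; rewrite /ostat nth_default // size_sort size_map.
  by case: r r_gt r_gt0.
apply: (measurability (@RGenCInfty.G R)).
  exact: RGenCInfty.measurableE.
move=> /= _ [_] [x] -> <-; rewrite setTI.
pose low w := (count (fun l : J => [ffun l => f l w < x]%R l) e < r)%N.
have mlow : measurable_fun setT low.
  apply: (@measurable_fun_finite_bools _ _ _ bool J (fun l w => f l w < x)%R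
    (fun b => (count (fun l => b l) e < r)%N)) => l.
  exact: measurable_fun_ltr.
rewrite [X in measurable X](_ : _ = low @^-1` [set true]).
  by rewrite -[X in measurable X]setTI; exact: mlow.
have lowE w : low w = (x <= ostat [seq f l w | l <- e] r).
  rewrite le_ostat ?r_gt0 ?size_map // count_map /low.
  by under eq_count do rewrite ffunE.
by apply/seteqP; split=> w; rewrite /preimage /= in_itv /= andbT lowE.
Qed.

Lemma measurable_fun_natr_case d (T : measurableType d) d' (U : measurableType d')
    (k : T -> nat) (G : nat -> T -> U) :
  measurable_fun setT k -> (forall i, measurable_fun setT (G i)) ->
  measurable_fun setT (fun w => G (k w) w).
Proof.
move=> mk mG _ Y mY; rewrite setTI.
rewrite [X in measurable X](_ : _ =
    \bigcup_i (k @^-1` [set i] `&` G i @^-1` Y)).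
  apply: bigcup_measurable => i _; apply: measurableI.
    by rewrite -[X in measurable X]setTI; exact: mk.
  by rewrite -[X in measurable X]setTI; exact: mG.
by apply/seteqP; split=> [w Yw|w [i _ [/= <-]]] //; exists (k w).
Qed.

(** * Laws of tuples, independence and exchangeability *)

(** Boxes are stable under intersection and generate the product sigma-algebra, so finite measures
    that agree on boxes are equal. *)
Lemma eq_measure_tuple d (V : measurableType d) (R : realType) (N : nat)
    (mu nu : {measure set (N.-tuple V) -> \bar R}) :
  (mu setT < +oo)%E ->
  (forall A : 'I_N -> set V, (forall i, measurable (A i)) ->
    mu [set s | forall i, A i (tnth s i)] = nu [set s | forall i, A i (tnth s i)]) ->
  forall B, measurable B -> mu B = nu B.
Proof.
move=> mu_fin munu.
pose G := [set [set s : N.-tuple V | forall i, A i (tnth s i)] |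
  A in [set A : 'I_N -> set V | forall i, measurable (A i)]].
have GT : G setT.
  exists (fun=> setT) => [i|]; first exact: measurableT.
  by apply/seteqP; split.
have mG : G `<=` measurable.
  move=> _ [A mA <-].
  rewrite (_ : [set s | _] =
      \bigcap_(i in [set: 'I_N]) ((fun s => tnth s i) @^-1` A i)).
    apply: fin_bigcap_measurable; first exact: finite_finset.
    move=> i _; rewrite -[X in measurable X]setTI.
    exact: measurable_tnth.
  by apply/seteqP; split=> s H i *; exact: H.
move=> B mB; apply: (measure_unique G (fun=> setT)) => //.
- apply/seteqP; split; last exact: (smallest_sub (@sigma_algebra_measurable _ _)).
  apply: smallest_sub; first exact: smallest_sigma_algebra.
  move=> C; rewrite -bigcup_seq => -[i _ [A mA]]; rewrite setTI => <-.
  apply: sub_sigma_algebra.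
  (* A cylinder over coordinate [i] is a box whose other sides are [setT]. *)
  exists (fun j => if j == i then A else setT) => [j /=|].
    by case: ifP => _ //; exact: measurableT.
  apply/seteqP; split=> [s /(_ i)|s As j]; first by rewrite eqxx.
  by case: eqP => // ->.
- move=> _ _ [A mA <-] [A' mA' <-].
  exists (fun i => A i `&` A' i) => [i|]; first exact: measurableI.
  by apply/seteqP; split=> s => [H|[H H'] i //]; split=> i; have [] := H i.
- by apply/seteqP; split=> // s _; exists 0%N.
- by move=> _ [A mA <-]; exact: munu.
Qed.

Lemma ge0_integral_distribution d d' (T : measurableType d) (S : measurableType d')
    (R : realType) (P : probability T R) (U : {mfun T >-> S}) (f : S -> \bar R) :
  measurable_fun setT f -> (forall z, 0 <= f z)%E ->
  (\int[distribution P U]_z f z = \int[P]_w f (U w))%E.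
Proof.
by move=> mf f0; rewrite /distribution ge0_integral_pushforward.
Qed.

Lemma ge0_integral_eq_law d d' (T : measurableType d) (S : measurableType d')
    (R : realType) (P : probability T R) (U W : T -> S) (f : S -> \bar R) :
  measurable_fun setT U -> measurable_fun setT W ->
  (forall B, measurable B -> P (U @^-1` B) = P (W @^-1` B)) ->
  measurable_fun setT f -> (forall z, 0 <= f z)%E ->
  (\int[P]_w f (U w) = \int[P]_w f (W w))%E.
Proof.
move=> mU mW UW mf f0.
pose X : {mfun T >-> S} := HB.pack U (isMeasurableFun.Build _ _ _ _ U mU).
pose Y : {mfun T >-> S} := HB.pack W (isMeasurableFun.Build _ _ _ _ W mW).
rewrite -[LHS](ge0_integral_distribution P X) //.
rewrite -[RHS](ge0_integral_distribution P Y) //.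
by apply: eq_measure_integral => B mB _; exact: UW.
Qed.

(** Independence says that the law of the pair is the product law, and Tonelli applies. The variable
    [W] stays outermost, so the inner integral plays the part of a conditional expectation given
    [W]. *)
Lemma ge0_integral_indep d d1 d2 (T : measurableType d) (S1 : measurableType d1)
    (S2 : measurableType d2) (R : realType) (P : probability T R)
    (U : T -> S1) (W : T -> S2) (f : S1 * S2 -> \bar R) :
  measurable_fun setT U -> measurable_fun setT W ->
  (forall A B, measurable A -> measurable B ->
    P (U @^-1` A `&` W @^-1` B) = P (U @^-1` A) * P (W @^-1` B))%E ->
  measurable_fun setT f -> (forall z, 0 <= f z)%E ->
  (\int[P]_w f (U w, W w) = \int[P]_w \int[P]_v f (U v, W w))%E.
Proof.
move=> mU mW UW mf f0.
pose X : {mfun T >-> S1} := HB.pack U (isMeasurableFun.Build _ _ _ _ U mU).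
pose Y : {mfun T >-> S2} := HB.pack W (isMeasurableFun.Build _ _ _ _ W mW).
have mUW : measurable_fun setT (fun w => (U w, W w)) by exact: measurable_fun_pair.
pose XY : {mfun T >-> (S1 * S2)%type} :=
  HB.pack (fun w => (U w, W w)) (isMeasurableFun.Build _ _ _ _ _ mUW).
rewrite -[LHS](ge0_integral_distribution P XY) //.
transitivity (\int[distribution P X \x distribution P Y]_z f z)%E.
  apply: eq_measure_integral => B mB _; apply/esym.
  by apply: product_measure_unique => // A C mA mC; exact: UW.
rewrite fubini_tonelli2 // ge0_integral_distribution //; last 2 first.
- exact: measurable_fun_fubini_tonelli_G.
- by move=> z; apply: integral_ge0 => v _; exact: f0.
apply: eq_integral => w _; rewrite /fubini_G ge0_integral_distribution //.
exact: measurable_fun_pair1.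
Qed.

Section independence.
Context d (T : measurableType d) (R : realType) (P : probability T R).
Context (I : finType) d' (V : measurableType d').
Variable W : I -> T -> V.

Lemma mutually_independent_comp d2 (V2 : measurableType d2) (f : V -> V2) :
  measurable_fun setT f -> mutually_independent P W ->
  mutually_independent P (fun i => f \o W i).
Proof.
move=> mf WI A mA; apply: (WI (fun i => f @^-1` A i)) => i.
by rewrite -[X in measurable X]setTI; exact: mf.
Qed.

Lemma iid_comp d2 (V2 : measurableType d2) (f : V -> V2) :
  measurable_fun setT f -> iid P W -> iid P (fun i => f \o W i).
Proof.
move=> mf [mW WI Wid]; split; first by move=> i; exact: measurableT_comp.
  exact: mutually_independent_comp.
move=> i j A mA; apply: (Wid i j (f @^-1` A)).
by rewrite -[X in measurable X]setTI; exact: mf.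
Qed.

(** Both intersections have product probabilities, which differ only in the factor at [a]; that
    factor is [1] once [A a] is replaced by [setT]. *)
Lemma mutually_independent_split (a : I) (A : I -> set V) :
  mutually_independent P W -> (forall i, measurable (A i)) ->
  (P (\bigcap_(i in [set: I]) (W i @^-1` A i)) = P (W a @^-1` A a) *
   P (\bigcap_(i in [set: I]) (W i @^-1` (if i == a then setT else A i))))%E.
Proof.
move=> WI mA; rewrite !WI //; last by move=> i; case: eqP => // _; exact: measurableT.
rewrite (bigD1 a) //=; congr (_ * _)%E.
rewrite [RHS](bigD1 a) //= eqxx preimage_setT probability_setT mul1e.
by apply: eq_bigr => i /negbTE ->.
Qed.

Lemma mutually_independent_pair (a b : I) : a != b ->
  mutually_independent P W ->
  forall A B, measurable A -> measurable B ->
  (P (W a @^-1` A `&` W b @^-1` B) = P (W a @^-1` A) * P (W b @^-1` B))%E.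
Proof.
move=> ab WI A B mA mB.
have := @mutually_independent_split a
  (fun i => if i == a then A else if i == b then B else setT) WI.
rewrite eqxx => H; rewrite (_ : _ `&` _ = \bigcap_(i in [set: I])
    (W i @^-1` (if i == a then A else if i == b then B else setT))).
  rewrite H => [|i]; last by do 2![case: ifP => // _]; exact: measurableT.
  congr (_ * P _)%E; apply/seteqP; split=> w => [/(_ b Logic.I)|Bw i _] /=.
    by rewrite eq_sym (negbTE ab) eqxx.
  by case: (i == a) => //; case: eqP => // ->.
apply/seteqP; split=> w => [[Aw Bw] i _ /=|H' /=].
  by case: ifP => [/eqP ->|_] //; case: ifP => [/eqP ->|_].
split; first by have := H' a Logic.I; rewrite /= eqxx.
by have := H' b Logic.I; rewrite /= eq_sym (negbTE ab) eqxx.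
Qed.

(** Entries in [D] are frozen at [v0]; [c] names the variable read by each other entry. The score
    vector with [T_j] replaced by [t_u] has this shape. *)
Definition partial_tuple N (D : pred 'I_N) (v0 : V) (c : 'I_N -> I) (w : T) : N.-tuple V :=
  [tuple if D k then v0 else W (c k) w | k < N].

Lemma measurable_partial_tuple N (D : pred 'I_N) v0 c :
  (forall i, measurable_fun setT (W i)) ->
  measurable_fun setT (@partial_tuple N D v0 c).
Proof.
move=> mW; apply/measurable_fun_tnthP => k.
rewrite (_ : _ \o _ = fun w => if D k then v0 else W (c k) w); last first.
  by apply/funext => w; rewrite /= tnth_mktuple.
by case: (D k) => //; exact: measurable_cst.
Qed.

(** For fixed [A], both sides are finite measures in [B]: a push-forward of [P] restricted to the
    event on [W a], and a multiple of the law of the tuple. By [eq_measure_tuple] only boxes remain,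
    and there [mutually_independent_split] applies. *)
Lemma mutually_independent_tuple (a : I) N (D : pred 'I_N) v0 c :
  (forall i, measurable_fun setT (W i)) -> mutually_independent P W ->
  (forall k, ~~ D k -> c k != a) ->
  forall A B, measurable A -> measurable B ->
  (P (W a @^-1` A `&` @partial_tuple N D v0 c @^-1` B) =
   P (W a @^-1` A) * P (@partial_tuple N D v0 c @^-1` B))%E.
Proof.
move=> mW WI ca A B mA mB; set U := @partial_tuple N D v0 c.
have mU : measurable_fun setT U by exact: measurable_partial_tuple.
have mE : measurable (W a @^-1` A).
  by rewrite -[X in measurable X]setTI; exact: mW.
have PE_ge0 : 0 <= fine (P (W a @^-1` A)) by rewrite fine_ge0.
pose X : {mfun T >-> (N.-tuple V)%type} := HB.pack U (isMeasurableFun.Build _ _ _ _ U mU).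
have [mu muE] : exists mu : {measure set (N.-tuple V) -> \bar R},
    forall C, mu C = P (U @^-1` C `&` W a @^-1` A).
  by exists (@measure_function_pushforward__canonical__measure_function_Measure
    _ _ _ _ _ (mrestr P mE) U mU).
pose nu : {measure set (N.-tuple V) -> \bar R} :=
  mscale (NngNum PE_ge0) (distribution P X).
have nuE C : nu C = (P (W a @^-1` A) * P (U @^-1` C))%E.
  by rewrite /nu /= /mscale /= fineK // fin_num_measure.
rewrite setIC -muE -nuE; apply: eq_measure_tuple => //.
  by rewrite muE (le_lt_trans (probability_le1 _ _)) ?ltry // preimage_setT setTI.
move=> C mC; rewrite muE nuE.
(* If a frozen entry violates its side of the box, the event on the tuple is empty and both sides
   vanish. *)
have [C0|] := pselect (forall k, D k -> C k v0); last first.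
  move=> nC0; rewrite (_ : U @^-1` _ = set0) ?set0I ?measure0 ?mule0 //.
  rewrite -subset0 => w /= Cw; apply: nC0 => k Dk.
  by have := Cw k; rewrite tnth_mktuple Dk.
(* Several entries may read the same variable, so the side for [i] gathers all their constraints. *)
pose A' i := if i == a then A else [set v | forall k, ~~ D k -> c k = i -> C k v].
have A'a : A' a = A by rewrite /A' eqxx.
have := @mutually_independent_split a A' WI; rewrite A'a => H.
have mA' i : measurable (A' i).
  rewrite /A'; case: ifP => // _.
  rewrite (_ : [set v | _] = \bigcap_(k in [set k | ~~ D k /\ c k = i]) C k).
    by apply: fin_bigcap_measurable => // ; exact: finite_finset.
  by apply/seteqP; split=> v Cv k => [[Dk ck]|Dk ck]; exact: Cv.
transitivity (P (\bigcap_(i in [set: I]) (W i @^-1` A' i))).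
  congr (P _); apply/seteqP; split=> w => [[/= Cw Aw] i _|Aw].
    rewrite /A' /=; case: eqP => [->|_] // k Dk <-.
    by have := Cw k; rewrite tnth_mktuple (negbTE Dk).
  split=> [k /=|]; last by have := Aw a Logic.I; rewrite /A' /= eqxx.
  rewrite tnth_mktuple; case: ifPn => [|Dk]; first exact: C0.
  have := Aw (c k) Logic.I; rewrite /A' /= (negbTE (ca _ Dk)); exact.
rewrite H //; congr (_ * P _)%E; apply/seteqP; split=> w => [Aw k /=|/= Cw i _].
  rewrite tnth_mktuple; case: ifPn => [|Dk]; first exact: C0.
  by have := Aw (c k) Logic.I; rewrite /A' /= (negbTE (ca _ Dk)); exact.
rewrite /=; case: eqP => // /eqP /negbTE ia; rewrite /A' ia => k Dk <-.
by have := Cw k; rewrite tnth_mktuple (negbTE Dk).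
Qed.

(** On a box, the permuted family has the product of the marginals, reindexed by [sigma]; equal
    marginals remove [sigma], and [eq_measure_tuple] extends the equality to the whole law. *)
Lemma iid_exchangeable (sigma : {perm I}) (phi : (I -> V) -> \bar R) :
  iid P W ->
  measurable_fun setT (fun s : #|I|.-tuple V => phi (fun i => tnth s (enum_rank i))) ->
  (forall z, 0 <= phi z)%E ->
  (\int[P]_w phi (W ^~ w) = \int[P]_w phi (fun i => W (sigma i) w))%E.
Proof.
move=> [mW WI Wid] mphi phi0.
pose U (s : {perm I}) w : #|I|.-tuple V := [tuple W (s (enum_val k)) w | k < #|I|].
have mU s : measurable_fun setT (U s).
  apply/measurable_fun_tnthP => k.
  rewrite (_ : _ \o _ = W (s (enum_val k))) //.
  by apply/funext => w; rewrite /= tnth_mktuple.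
have phiU (s : {perm I}) w :
    phi (fun i => W (s i) w) = phi (fun i => tnth (U s w) (enum_rank i)).
  by congr phi; apply/funext => i; rewrite tnth_mktuple enum_rankK.
have PU (s : {perm I}) (C : 'I_#|I| -> set V) : (forall k, measurable (C k)) ->
    P (U s @^-1` [set t | forall k, C k (tnth t k)]) =
    (\prod_(i : I) P (W i @^-1` C (enum_rank i)))%E.
  move=> mC.
  rewrite (_ : _ @^-1` _ = \bigcap_(i in [set: I]) (W i @^-1` C (enum_rank ((s^-1)%g i)))).
    rewrite WI // (reindex_inj (@perm_inj _ s)) /=.
    by apply: eq_bigr => i _; rewrite permK; exact: Wid.
  apply/seteqP; split=> w Cw => [i _ /=|k /=].
    have := Cw (enum_rank ((s^-1)%g i)).
    by rewrite tnth_mktuple enum_rankK permKV.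
  have := Cw (s (enum_val k)) Logic.I.
  by rewrite /= permK enum_valK tnth_mktuple.
transitivity (\int[P]_w phi (fun i => W ((1%g : {perm I}) i) w))%E.
  by apply: eq_integral => w _; congr phi; apply/funext => i; rewrite perm1.
under eq_integral do rewrite phiU; under [RHS]eq_integral do rewrite phiU.
apply: (ge0_integral_eq_law (mU 1%g) (mU sigma) _ mphi) => // B mB.
pose X s : {mfun T >-> (#|I|.-tuple V)%type} :=
  HB.pack (U s) (isMeasurableFun.Build _ _ _ _ _ (mU s)).
apply: (@eq_measure_tuple _ _ _ _ (distribution P (X 1%g)) (distribution P (X sigma))) => //.
  by rewrite /= probability_setT ltry.
by move=> C mC; exact: (etrans (PU 1%g C mC) (esym (PU sigma C mC))).
Qed.

End independence.

Lemma count_enum (I : finType) (p : pred I) : count p (enum I) = #|[pred i | p i]|.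
Proof. by rewrite cardE -size_filter enumT. Qed.

Lemma count_tuple (A : eqType) N (s : N.-tuple A) (p : pred A) :
  count p s = #|[pred k | p (tnth s k)]|.
Proof. by rewrite -{1}(map_tnth_enum s) count_map count_enum. Qed.

(** * Leave-one-out thresholds: identities for a fixed sample *)

Section leave_one_out.
Context {R : realType} {n m : nat}.
Local Notation index := ('I_n + 'I_m)%type.
Variables (alpha t_u : R) (kappa : m.-tuple R -> nat).
Implicit Types (j l : 'I_m) (z : index -> R * R) (a b : index).

Definition tests z : m.-tuple R := [tuple (z (inr l)).1 | l < m].

Definition masked j z : m.-tuple R := replace_at (tests z) j t_u.

(** Entry [j] of [s], which is [t_u] in a masked vector, enters only through [kappa s]. *)
Definition loo_threshold j (s : m.-tuple R) : R :=
  ostat [seq tnth s l | l <- [seq l <- enum 'I_m | l != j]] (kappa s).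

Definition threshold j z : R := loo_threshold j (masked j z).

(* The indices exchangeable with test index [j] given the other test scores. *)
Definition augmented j a : bool := if a is inr l then l == j else true.

Definition selected j z a : bool := (z a).1 <= threshold j z.

Definition num_selected j z : nat := #|[pred a | augmented j a && selected j z a]|.

(** The rank is taken in the whole selected group, [a] included, which makes the condition symmetric
    in the augmented indices. As [a] is never strictly below itself, the case [a = inr j] compares
    [j] with the calibration points alone. *)
Definition exceeds j z a : bool :=
  [&& augmented j a, selected j z a &
    (conf_index alpha (num_selected j z) <=
     #|[pred b | [&& augmented j b, selected j z b & ((z b).2 < (z a).2)%R]]|)%N].

Lemma card_augmented j (Q : pred index) :
  #|[pred a | augmented j a && Q a]| = (#|[pred c | Q (inl c)]| + Q (inr j))%N.
Proof.
rewrite -!sum1_card big_mkcond big_sumType /= -big_mkcond /=; congr (_ + _)%N.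
rewrite (bigD1 j) //= big1 => [|l /negbTE lj]; rewrite inE /= ?lj //.
by rewrite eqxx /=; case: (Q _).
Qed.

Lemma card_augmentedT j : #|[pred a | augmented j a]| = n.+1.
Proof.
have := card_augmented j predT; rewrite addn1 => cardE.
rewrite (_ : #|_| = #|[pred c : 'I_n | predT (inl c : index)]|.+1).
  by congr _.+1; rewrite -[RHS]card_ord; apply: eq_card.
by rewrite -cardE; apply: eq_card => a; rewrite !inE andbT.
Qed.

(** The transposition moves no test index other than [j], and slot [j] is overwritten by [t_u]. *)
Lemma masked_tperm j a z : augmented j a -> masked j (z \o tperm (inr j) a) = masked j z.
Proof.
move=> ja; apply: eq_from_tnth => l; rewrite !tnth_mktuple /=.
case: eqP => // /eqP lj; rewrite tpermD //.
  by apply: contra lj => /eqP[->].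
by apply: contraTneq ja => ->.
Qed.

Lemma augmented_tperm j a b : augmented j a -> augmented j (tperm (inr j) a b) = augmented j b.
Proof. by move=> ja; case: tpermP => // ->; rewrite /= ?eqxx ?ja. Qed.

Lemma threshold_tperm j a z : augmented j a ->
  threshold j (z \o tperm (inr j) a) = threshold j z.
Proof. by move=> ja; rewrite /threshold masked_tperm. Qed.

(** The threshold is invariant under the swap, and the two cardinals are only reindexed by it. *)
Lemma exceeds_tperm j a b z : augmented j a ->
  exceeds j (z \o tperm (inr j) a) b = exceeds j z (tperm (inr j) a b).
Proof.
move=> ja; set s := tperm (inr j) a.
have selE c : selected j (z \o s) c = selected j z (s c).
  by rewrite /selected threshold_tperm.
have cardE (Q Q' : pred index) : (forall c, Q c = Q' (s c)) ->
    #|[pred c | Q c]| = #|[pred c | Q' c]|.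
  move=> QE; rewrite -!sum1_card [RHS](reindex_inj (@perm_inj _ s)) /=.
  by apply: eq_bigl => c; rewrite !inE QE.
rewrite /exceeds selE augmented_tperm //; congr [&& _, _ & (_ <= _)%N].
  congr conf_index; apply: cardE => c; rewrite selE augmented_tperm //.
by apply: cardE => c; rewrite selE augmented_tperm.
Qed.

(** With distinct residuals, [card_rank_ge] applies to the selected augmented indices. The total
    thus depends on the sample through [num_selected] alone. *)
Lemma sum_exceeds j z : {in augmented j &, injective (fun a => (z a).2)} ->
  \sum_(a | augmented j a) (exceeds j z a : nat) =
    (num_selected j z - conf_index alpha (num_selected j z))%N.
Proof.
move=> zinj; pose A : {pred index} := [pred a | augmented j a && selected j z a].
rewrite -(@card_rank_ge _ _ A (fun a => (z a).2)); last first.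
  by move=> a b; rewrite !inE => /andP[ja _] /andP[jb _]; exact: zinj.
rewrite -sum1_card [RHS]big_mkcond [LHS]big_mkcond; apply: eq_bigr => a _.
rewrite /exceeds !inE; case: (augmented j a) => //=; case: (selected j z a) => //=.
rewrite (_ : #|[pred b | _]| = #|[pred b in A | ((z b).2 < (z a).2)%R]|).
  by case: (_ <= _)%N.
by apply: eq_card => b; rewrite !inE andbA.
Qed.

Lemma num_selectedE j z :
  num_selected j z = \sum_(a | augmented j a) (selected j z a : nat).
Proof.
rewrite /num_selected -sum1_card big_mkcond [RHS]big_mkcond; apply: eq_bigr => a _.
by rewrite inE; case: (augmented j a) => //=; case: (selected j z a).
Qed.

Lemma le_threshold j z (t : R) : (1 <= kappa (masked j z) <= m.-1)%N ->
  (t <= threshold j z) =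
  (#|[pred l | (l != j) && ((z (inr l)).1 < t)%R]| < kappa (masked j z))%N.
Proof.
move=> /andP[k_gt0 k_le]; rewrite /threshold /loo_threshold.
have size_loo : size [seq l <- enum 'I_m | l != j] = m.-1.
  rewrite size_filter count_enum; have := cardC1 j; rewrite card_ord => <-.
  by apply: eq_card.
rewrite le_ostat ?size_map ?size_loo ?k_gt0 // count_map count_filter count_enum.
congr (_ < _)%N; apply: eq_card => l; rewrite !inE /= !tnth_mktuple.
by case: eqP => //=; rewrite ?andbF ?andbT.
Qed.

Lemma le_ostat_tests z (t : R) (r : nat) : (1 <= r <= m)%N ->
  (t <= ostat (tests z) r) = (#|[pred l | ((z (inr l)).1 < t)%R]| < r)%N.
Proof.
move=> r_bnd; rewrite le_ostat ?size_tuple // count_tuple.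
by congr (_ < _)%N; apply: eq_card => l; rewrite !inE tnth_mktuple.
Qed.

Section test_driven.
Variables (z : index -> R * R).
Hypothesis kappa_masked : forall j, kappa (masked j z) = kappa (tests z).
Hypothesis kappa_bnd : (1 <= kappa (tests z) <= m.-1)%N.

Lemma le_threshold_tests j (t : R) :
  (t <= threshold j z) =
  (#|[pred l | (l != j) && ((z (inr l)).1 < t)%R]| < kappa (tests z))%N.
Proof. by rewrite le_threshold kappa_masked. Qed.

Lemma card_lt_split j (t : R) :
  #|[pred l | ((z (inr l)).1 < t)%R]| =
  (((z (inr j)).1 < t)%R + #|[pred l | (l != j) && ((z (inr l)).1 < t)%R]|)%N.
Proof.
by rewrite (cardD1 j) inE; congr (_ + _)%N; apply: eq_card => l; rewrite !inE.
Qed.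

(** At the level [T_j] the counts of scores strictly below, with and without [j], coincide. *)
Lemma selected_test j :
  selected j z (inr j) = ((z (inr j)).1 <= ostat (tests z) (kappa (tests z))).
Proof.
move: kappa_bnd => /andP[k_gt0 k_le].
rewrite /selected le_threshold_tests le_ostat_tests ?k_gt0 ?(leq_trans k_le) ?leq_pred //.
by rewrite (card_lt_split j) ltxx.
Qed.

(** Putting back a score [T_j] that is at most the threshold raises the rank of the threshold among
    the scores from [kappa] to [kappa + 1]. The two reals are identified by comparing their lower
    bounds [t]. *)
Lemma ostat_threshold j : selected j z (inr j) ->
  ostat (tests z) (kappa (tests z)).+1 = threshold j z.
Proof.
move: kappa_bnd => /andP[k_gt0 k_le] sel.
have le_iff t : (t <= ostat (tests z) (kappa (tests z)).+1) = (t <= threshold j z).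
  rewrite le_threshold_tests le_ostat_tests; last first.
    (* A positive [kappa] bounded by [m.-1] excludes [m = 0], so rank [kappa + 1] is within
       range. *)
    by case: (m) k_le k_gt0 => [|m'] //; rewrite leqNgt; case: (kappa _).
  rewrite (card_lt_split j); have [|le_t] := ltP; first by rewrite add1n ltnS.
  (* Here [t <= T_j], and the selection of [j] leaves fewer than [kappa] other scores below [T_j],
     hence below [t]: both comparisons hold. *)
  have : (#|[pred l | (l != j) && ((z (inr l)).1 < t)%R]| < kappa (tests z))%N.
    apply: (leq_ltn_trans _ (_ : (#|[pred l | (l != j) &&
      ((z (inr l)).1 < (z (inr j)).1)%R]| < kappa (tests z))%N)).
      apply: subset_leq_card; apply/fintype.subsetP => l; rewrite !inE => /andP[-> /=].
      by move=> /lt_le_trans; exact.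
    by move: sel; rewrite /selected le_threshold_tests.
  by move=> lt_k; rewrite lt_k add0n ltnS ltnW.
by apply/eqP; rewrite eq_le -le_iff lexx /= le_iff lexx.
Qed.

Lemma card_selected_tests : injective (fun l => (z (inr l)).1) ->
  #|[pred j | selected j z (inr j)]| = kappa (tests z).
Proof.
move: kappa_bnd => /andP[k_gt0 k_le] zinj.
rewrite -[RHS](card_rank_lt zinj); last by rewrite card_ord (leq_trans k_le) ?leq_pred.
apply: eq_card => j; rewrite !inE selected_test le_ostat_tests //.
by rewrite k_gt0 (leq_trans k_le) ?leq_pred.
Qed.

End test_driven.
End leave_one_out.

(** * Measurability of the leave-one-out quantities *)

Section leave_one_out_measurable.
Context {R : realType} {n m : nat}.
Local Notation index := ('I_n + 'I_m)%type.
Variables (alpha t_u : R) (kappa : m.-tuple R -> nat).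
Hypothesis mkappa : measurable_fun setT kappa.
Implicit Types (j l : 'I_m) (a b : index).

Lemma measurable_loo_threshold j : measurable_fun setT (loo_threshold kappa j).
Proof.
apply: (measurable_fun_natr_case
  (G := fun r s => ostat [seq tnth s l | l <- [seq l <- enum 'I_m | l != j]] r)) => // r.
by apply: measurable_ostat => l; exact: measurable_tnth.
Qed.

Context d (T : measurableType d) (Z : index -> T -> R * R).
Hypothesis mZ : forall a, measurable_fun setT (Z a).
Local Notation z w := (Z ^~ w).

Lemma measurable_masked j : measurable_fun setT (fun w => masked t_u j (z w)).
Proof.
apply/measurable_fun_tnthP => l.
rewrite (_ : _ \o _ = fun w => if l == j then t_u else (Z (inr l) w).1); last first.
  by apply/funext => w; rewrite /= !tnth_mktuple.
by case: (l == j); [exact: measurable_cst | exact: measurableT_comp].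
Qed.

Lemma measurable_threshold j : measurable_fun setT (fun w => threshold t_u kappa j (z w)).
Proof.
by apply: (measurableT_comp (measurable_loo_threshold j)); exact: measurable_masked.
Qed.

Lemma measurable_selected j a :
  measurable_fun setT (fun w => selected t_u kappa j (z w) a).
Proof.
by apply: measurable_fun_ler; [exact: measurableT_comp | exact: measurable_threshold].
Qed.

Lemma measurable_exceeds j a :
  measurable_fun setT (fun w => exceeds alpha t_u kappa j (z w) a).
Proof.
pose K := (index + index)%type.
pose B (p : K) w := match p with
  | inl b => selected t_u kappa j (z w) b
  | inr b => (Z b w).2 < (Z a w).2 end.
pose G (b : {ffun K -> bool}) := [&& augmented j a, b (inl a) &
  (conf_index alpha #|[pred c | augmented j c && b (inl c)]| <=
   #|[pred c | [&& augmented j c, b (inl c) & b (inr c)]]|)%N].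
rewrite (_ : (fun w => _) = (fun w => G [ffun p => B p w])).
  apply: measurable_fun_finite_bools => -[b|b] /=; first exact: measurable_selected.
  by apply: measurable_fun_ltr; exact: measurableT_comp.
apply/funext => w; rewrite /exceeds /G /num_selected ffunE /=; congr [&& _, _ & (_ <= _)%N].
  by congr conf_index; apply: eq_card => c; rewrite !inE ffunE.
by apply: eq_card => c; rewrite !inE !ffunE.
Qed.

Lemma measurable_num_selected j :
  measurable_fun setT (fun w => num_selected t_u kappa j (z w)).
Proof.
pose G (b : {ffun index -> bool}) := #|[pred c | augmented j c && b c]|.
rewrite (_ : (fun w => _) =
    (fun w => G [ffun c => selected t_u kappa j (z w) c])).
  by apply: measurable_fun_finite_bools => c; exact: measurable_selected.
by apply/funext => w; apply: eq_card => c; rewrite !inE ffunE.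
Qed.

End leave_one_out_measurable.

Lemma measurable_fun_natr_bool d (T : measurableType d) (R : realType) (b : T -> bool) :
  measurable_fun setT b -> measurable_fun setT (fun w => (b w : nat)%:R : R).
Proof.
move=> mb; rewrite (_ : (fun w => _) = (fun w => if b w then 1 else 0)).
  by apply: measurable_fun_ifT.
by apply/funext => w; case: (b w).
Qed.

Lemma measurable_fun_natr d (T : measurableType d) (R : realType) (k : T -> nat) :
  measurable_fun setT k -> measurable_fun setT (fun w => (k w)%:R : R).
Proof. by move=> mk; apply: (measurable_fun_natr_case (G := fun r _ => r%:R : R)). Qed.

(** Inversion is continuous off the closed set of the single point [0], which is treated apart. *)
Lemma measurable_fun_inv d (T : measurableType d) (R : realType) (f : T -> R) :
  measurable_fun setT f -> measurable_fun setT (fun w => (f w)^-1).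
Proof.
move=> mf; apply: (measurableT_comp (f := fun x : R => x^-1)) => //.
rewrite -(setvU [set (0 : R)]); apply/measurable_funU => //.
  exact: measurableC.
split; last exact: measurable_fun_set1.
apply: open_continuous_measurable_fun.
  by apply: closed_openC; exact: closed_eq.
by move=> x /set_mem /= /eqP x0; exact: inv_continuous.
Qed.

(** * Almost sure absence of ties *)

(** Given [W], the event [U = W] asks [U] to hit one fixed value, which has probability zero;
    integrating over [W] keeps it null. *)
Lemma indep_continuous_neq d (T : measurableType d) (R : realType)
    (P : probability T R) (U W : T -> R) :
  measurable_fun setT U -> measurable_fun setT W ->
  (forall A B, measurable A -> measurable B ->
    P (U @^-1` A `&` W @^-1` B) = P (U @^-1` A) * P (W @^-1` B))%E ->
  continuous_rv P U -> {ae P, forall w, U w <> W w}.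
Proof.
move=> mU mW UW cU; pose S := [set w | U w = W w].
have mS : measurable S.
  rewrite (_ : S = (fun w => U w == W w) @^-1` [set true]).
    by rewrite -[X in measurable X]setTI; exact: measurable_fun_eqr.
  by apply/seteqP; split=> w /= /eqP.
exists S; split => //; last by move=> w /contrapT.
pose f (v : R * R) : \bar R := ((v.1 == v.2) : nat)%:R%:E.
have mf : measurable_fun setT f.
  apply/measurable_EFinP; apply: measurable_fun_natr_bool.
  by apply: measurable_fun_eqr.
rewrite -[S]setIT -(@integral_indic _ _ _ P setT) //.
transitivity (\int[P]_w f (U w, W w))%E.
  apply: eq_integral => w _; rewrite indicE /f /=.
  by congr (_%:R%:E); congr nat_of_bool; apply/idP/eqP; [move/set_mem|move=> ?; exact: mem_set].
rewrite ge0_integral_indep //; last by move=> v; rewrite lee_fin.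
apply: integral0_eq => w _; rewrite -[RHS](cU (W w)).
rewrite -[X in _ = P X]setIT -(@integral_indic _ _ _ P setT) //; last first.
  by rewrite -[X in measurable X]setTI; exact: (mU measurableT [set W w]).
apply: eq_integral => v _; rewrite indicE /f /=.
by congr (_%:R%:E); congr nat_of_bool; apply/eqP/idP; [move=> ?; exact: mem_set|move/set_mem].
Qed.

Lemma iid_continuous_injective d (T : measurableType d) (R : realType)
    (P : probability T R) (I : finType) (W : I -> T -> R) :
  iid P W -> (forall a, continuous_rv P (W a)) ->
  {ae P, forall w, injective (W ^~ w)}.
Proof.
move=> [mW indW _] cW.
have : {ae P, forall w, forall p : I * I, p.1 != p.2 -> W p.1 w <> W p.2 w}.
  apply: filter_forall => -[a b] /=; have [ab|ab] := eqVneq a b; first exact: aeW.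
  apply: filterS (indep_continuous_neq (mW a) (mW b)
    (mutually_independent_pair ab indW) (cW a)) => w /= neq _; exact: neq.
apply: filterS => w neq a b eqab; apply/eqP/negPn/negP => ab.
exact: (neq (a, b) ab eqab).
Qed.

(** * Integrals of nonnegative real functions *)

Section real_integrals.
Context d (T : measurableType d) (R : realType) (P : probability T R).

Lemma integral_fin_sum (I : finType) (Q : pred I) (f : I -> T -> R) :
  (forall i, measurable_fun setT (f i)) -> (forall i w, 0 <= f i w) ->
  (\int[P]_w (\sum_(i | Q i) f i w)%:E = \sum_(i | Q i) \int[P]_w (f i w)%:E)%E.
Proof.
move=> mf f0; rewrite -big_filter -ge0_integral_sum //.
- by apply: eq_integral => w _; rewrite big_filter sumEFin.
- by move=> i; exact/measurable_EFinP.
- by move=> i w _; rewrite lee_fin.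
Qed.

Lemma measurable_fin_sum (I : finType) (Q : pred I) (f : I -> T -> R) :
  (forall i, measurable_fun setT (f i)) ->
  measurable_fun setT (fun w => \sum_(i | Q i) f i w).
Proof.
by move=> mf; under eq_fun do rewrite -big_filter; exact: measurable_sum.
Qed.

Lemma integral_bool (b : T -> bool) : measurable_fun setT b ->
  (\int[P]_w ((b w : nat)%:R : R)%:E)%E = P [set w | b w].
Proof.
move=> mb; have mS : measurable [set w | b w].
  by rewrite -[X in measurable X]setTI; exact: (mb measurableT [set true]).
rewrite -[X in _ = P X]setIT -(@integral_indic _ _ _ P setT) //.
apply: eq_integral => w _; rewrite indicE; congr (_%:R%:E); congr nat_of_bool.
by apply/idP/idP => [bw|/set_mem]; first exact: mem_set.
Qed.

Section nonnegative.
Variables f g : T -> R.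
Hypotheses (mf : measurable_fun setT f) (mg : measurable_fun setT g).
Hypotheses (f0 : forall w, 0 <= f w) (g0 : forall w, 0 <= g w).

Lemma integralZr_real (c : R) : 0 <= c ->
  (\int[P]_w (f w * c)%:E = (\int[P]_w (f w)%:E) * c%:E)%E.
Proof.
move=> c0; under eq_integral do rewrite EFinM.
apply: ge0_integralZr => //; first exact/measurable_EFinP.
by move=> w _; rewrite lee_fin.
Qed.

Lemma integralD_real :
  (\int[P]_w (f w + g w)%:E = \int[P]_w (f w)%:E + \int[P]_w (g w)%:E)%E.
Proof.
under eq_integral do rewrite EFinD.
by apply: ge0_integralD => //; (exact/measurable_EFinP || (move=> w _; rewrite lee_fin)).
Qed.

Lemma le_integral_real : (forall w, f w <= g w) ->
  (\int[P]_w (f w)%:E <= \int[P]_w (g w)%:E)%E.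
Proof.
move=> fg; apply: ge0_le_integral => //; try exact/measurable_EFinP.
  by move=> w _; rewrite lee_fin.
by move=> w _; rewrite lee_fin.
Qed.

Lemma ae_eq_integral_real : {ae P, forall w, f w = g w} ->
  (\int[P]_w (f w)%:E = \int[P]_w (g w)%:E)%E.
Proof.
move=> fg; apply: ae_eq_integral => //; try exact/measurable_EFinP.
by apply: filterS fg => w -> _.
Qed.

End nonnegative.

End real_integrals.

(** * Expectations of selection and of exceedance for a fixed test index *)

Section calibrated_selection.
Context d (T : measurableType d) (R : realType) (P : probability T R) (n m : nat).
Local Notation index := ('I_n + 'I_m)%type.
Variables (Z : index -> T -> R * R) (alpha t_u : R) (kappa : m.-tuple R -> nat).
Variable F : R -> R.
Hypothesis alpha01 : 0 < alpha < 1.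
Hypothesis iidZ : iid P Z.
Hypothesis contR : forall a, continuous_rv P (fun w => (Z a w).2).
Hypothesis mkappa : measurable_fun setT kappa.
Hypothesis FE : forall a t, (F t)%:E = P [set w | (Z a w).1 <= t].
Local Notation z w := (Z ^~ w).
Local Notation masked := (masked t_u).
Local Notation threshold := (threshold t_u kappa).
Local Notation selected := (selected t_u kappa).
Local Notation num_selected := (num_selected t_u kappa).
Local Notation exceeds := (exceeds alpha t_u kappa).
Implicit Types (j l : 'I_m) (a b : index).

Let mZ a : measurable_fun setT (Z a). Proof. by have [mZ _ _] := iidZ. Qed.

Let iid1 : iid P (fun a => fst \o Z a). Proof. exact: iid_comp. Qed.
Let iid2 : iid P (fun a => snd \o Z a). Proof. exact: iid_comp. Qed.

Lemma score_cdf_ge0 a t : 0 <= F t.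
Proof. by rewrite -lee_fin (FE a) measure_ge0. Qed.

Lemma measurable_score_cdf a : measurable_fun setT F.
Proof.
have mle t : measurable [set w | (Z a w).1 <= t].
  have mb : measurable_fun setT (fun w => (Z a w).1 <= t).
    by apply: measurable_fun_ler => //; exact: measurableT_comp.
  by rewrite -[X in measurable X]setTI; exact: (mb measurableT [set true]).
apply: nondecreasing_measurable => // s t st.
rewrite -lee_fin !(FE a); apply: le_measure; [exact: mem_set|exact: mem_set|].
by move=> w /= /le_trans; exact.
Qed.

(** No entry of the masked vector reads [Z a]: slot [j] is frozen, and a calibration index is not a
    test index. Given that vector, which fixes the threshold, [a] is therefore selected with
    probability [F] of the threshold. *)
Lemma integral_selected j a (q : m.-tuple R -> R) : augmented j a ->
  measurable_fun setT q -> (forall s, 0 <= q s) ->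
  (\int[P]_w ((selected j (z w) a : nat)%:R * q (masked j (z w)))%:E =
   \int[P]_w (F (threshold j (z w)) * q (masked j (z w)))%:E)%E.
Proof.
move=> ja mq q0; have [m1 ind1 _] := iid1.
pose f (v : R * m.-tuple R) : \bar R :=
  (((v.1 <= loo_threshold kappa j v.2)%R : nat)%:R * q v.2)%:E.
have mf : measurable_fun setT f.
  apply/measurable_EFinP/measurable_funM; last exact: measurableT_comp.
  apply: measurable_fun_natr_bool; apply: measurable_fun_ler => //.
  apply: (measurableT_comp (measurable_loo_threshold mkappa j)).
  exact: measurable_snd.
have maskedE w : masked j (z w) =
    partial_tuple (fun a => fst \o Z a) (pred1 j) t_u inr w.
  by apply: eq_from_tnth => l; rewrite !tnth_mktuple.
transitivity (\int[P]_w f ((Z a w).1, masked j (z w)))%E; first exact: eq_integral.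
rewrite (@ge0_integral_indep _ _ _ _ _ _ _ P (fst \o Z a) (fun w => masked j (z w))) //.
- apply: eq_integral => w _; rewrite /f /= integralZr_real //.
  + rewrite integral_bool -?FE //; apply: measurable_fun_ler => //; exact: m1.
  + by apply: measurable_fun_natr_bool; apply: measurable_fun_ler => //; exact: m1.
- exact: measurable_masked.
- move=> A B mA mB; rewrite (_ : (fun w => masked j (z w)) =
    partial_tuple (fun a => fst \o Z a) (pred1 j) t_u inr); last exact/funext.
  apply: (@mutually_independent_tuple _ _ _ P _ _ _ _ a _ (pred1 j) t_u inr m1 ind1) => // l lj.
  by apply: contraTneq ja => <-.
- by move=> v; rewrite lee_fin mulr_ge0.
Qed.

(** Swapping [inr j] and [a] preserves the joint law and the weight, and carries one exceedance to
    the other. *)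
Lemma integral_exceeds j a : augmented j a ->
  (\int[P]_w ((exceeds j (z w) a : nat)%:R / (kappa (masked j (z w)))%:R)%:E =
   \int[P]_w ((exceeds j (z w) (inr j) : nat)%:R / (kappa (masked j (z w)))%:R)%:E)%E.
Proof.
move=> ja; pose phi (y : index -> R * R) : \bar R :=
  ((exceeds j y (inr j) : nat)%:R / (kappa (masked j y))%:R)%:E.
rewrite [RHS](_ : _ = \int[P]_w phi (Z ^~ w))%E //.
rewrite (@iid_exchangeable _ _ _ P _ _ _ Z (tperm (inr j) a)) //; last 2 first.
- pose Y b (s : #|{: index}|.-tuple (R * R)) := tnth s (enum_rank b).
  have mY b : measurable_fun setT (Y b) by exact: measurable_tnth.
  apply/measurable_EFinP; apply: measurable_funM.
    by apply: measurable_fun_natr_bool; exact: (measurable_exceeds alpha t_u mkappa mY).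
  apply: measurable_fun_inv; apply: measurable_fun_natr.
  by apply: (measurableT_comp mkappa); exact: (measurable_masked t_u mY).
- by move=> y; rewrite lee_fin divr_ge0.
apply: eq_integral => w _; rewrite /phi.
rewrite (_ : (fun i => _) = (z w) \o tperm (inr j) a) //.
by rewrite exceeds_tperm // masked_tperm // tpermL.
Qed.

Let mkappa_masked j : measurable_fun setT (fun w => kappa (masked j (z w))).
Proof. by apply: (measurableT_comp mkappa); exact: measurable_masked. Qed.

Let mthreshold j : measurable_fun setT (fun w => threshold j (z w)).
Proof. exact: measurable_threshold. Qed.

Let mselected j a : measurable_fun setT (fun w => ((selected j (z w) a) : nat)%:R : R).
Proof. by apply: measurable_fun_natr_bool; exact: measurable_selected. Qed.

Let mexceeds j a : measurable_fun setT (fun w => ((exceeds j (z w) a) : nat)%:R : R).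
Proof. by apply: measurable_fun_natr_bool; exact: measurable_exceeds. Qed.

Let mnum_selected j : measurable_fun setT (fun w => num_selected j (z w)).
Proof. exact: measurable_num_selected. Qed.

Let mmasked j : measurable_fun setT (fun w => masked j (z w)).
Proof. exact: measurable_masked. Qed.

Lemma integral_augmented_const j (f : index -> T -> R) (c : \bar R) :
  (forall a, measurable_fun setT (f a)) -> (forall a w, 0 <= f a w) ->
  (forall a, augmented j a -> \int[P]_w (f a w)%:E = c)%E ->
  (\int[P]_w (\sum_(a | augmented j a) f a w)%:E = n.+1%:R%:E * c)%E.
Proof.
move=> mf f0 fc; rewrite integral_fin_sum // (eq_bigr _ fc).
rewrite (eq_bigl (mem [pred a | augmented j a])) // sumr_const.
by rewrite (@card_augmentedT n m j) mule_natl.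
Qed.

Lemma integral_num_selected j (q : m.-tuple R -> R) :
  measurable_fun setT q -> (forall s, 0 <= q s) ->
  (\int[P]_w ((num_selected j (z w))%:R * q (masked j (z w)))%:E =
   n.+1%:R%:E * \int[P]_w (F (threshold j (z w)) * q (masked j (z w)))%:E)%E.
Proof.
move=> mq q0.
have mqm : measurable_fun setT (fun w => q (masked j (z w))).
  by apply: (measurableT_comp mq); exact: measurable_masked.
rewrite -(@integral_augmented_const j
  (fun a w => (selected j (z w) a : nat)%:R * q (masked j (z w)))).
- by apply: eq_integral => w _; rewrite num_selectedE natr_sum mulr_suml.
- by move=> a; exact: measurable_funM.
- by move=> a w; rewrite mulr_ge0.
- by move=> a ja; exact: integral_selected.
Qed.

(** All [n + 1] augmented indices contribute equally, and off the null event of tied residuals their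
    sum is given by [sum_exceeds]. *)
Lemma integral_exceeds_sum j :
  (n.+1%:R%:E *
   \int[P]_w ((exceeds j (z w) (inr j) : nat)%:R / (kappa (masked j (z w)))%:R)%:E =
   \int[P]_w ((num_selected j (z w) - conf_index alpha (num_selected j (z w)))%:R
              / (kappa (masked j (z w)))%:R)%:E)%E.
Proof.
have mk : measurable_fun setT (fun w => (kappa (masked j (z w)))%:R^-1 : R).
  by apply: measurable_fun_inv; exact: measurable_fun_natr.
rewrite -(@integral_augmented_const j
  (fun a w => (exceeds j (z w) a : nat)%:R / (kappa (masked j (z w)))%:R)); last 3 first.
- by move=> a; exact: measurable_funM.
- by move=> a w; rewrite divr_ge0.
- by move=> a ja; exact: integral_exceeds.
apply: ae_eq_integral_real.
- by apply: measurable_fin_sum => a; exact: measurable_funM.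
- apply: measurable_funM => //; exact: (measurable_fun_natr_case
    (G := fun r (_ : T) => (r - conf_index alpha r)%:R : R)).
apply: filterS (iid_continuous_injective iid2 contR) => w inj.
rewrite -mulr_suml -natr_sum sum_exceeds //.
by move=> a b _ _; exact: inj.
Qed.

Let q (s : m.-tuple R) : R := (kappa s)%:R^-1.

Let q_ge0 s : 0 <= q s. Proof. by rewrite invr_ge0. Qed.

Let mq : measurable_fun setT q.
Proof. by apply: measurable_fun_inv; exact: measurable_fun_natr. Qed.

Let mqm j : measurable_fun setT (fun w => q (masked j (z w))).
Proof. by apply: (measurableT_comp mq); exact: measurable_masked. Qed.

Let mgap j : measurable_fun setT (fun w =>
  (num_selected j (z w) - conf_index alpha (num_selected j (z w)))%:R : R).
Proof.
exact: (measurable_fun_natr_case (G := fun r (_ : T) => (r - conf_index alpha r)%:R : R)).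
Qed.

Let gap_le N : (N - conf_index alpha N)%:R <= alpha * N%:R.
Proof.
rewrite natrB ?conf_index_le //; have /andP[_ /(conf_index_ge N)] := alpha01; lra.
Qed.

Let gap_ge N : alpha * N%:R <= (N - conf_index alpha N)%:R + 1.
Proof.
rewrite natrB ?conf_index_le //; have /andP[_ /(conf_index_lt N)] := alpha01; lra.
Qed.

(** After multiplication by [n + 1] both sides are expectations of functions of [num_selected] with
    the same weight, and [gap_le] compares them pointwise. *)
Lemma exceeds_upper j :
  (\int[P]_w ((exceeds j (z w) (inr j) : nat)%:R / (kappa (masked j (z w)))%:R)%:E <=
   alpha%:E *
   \int[P]_w ((selected j (z w) (inr j) : nat)%:R / (kappa (masked j (z w)))%:R)%:E)%E.
Proof.
have /andP[/ltW alpha0 _] := alpha01.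
have jj : augmented j (inr j : index) by rewrite /= eqxx.
rewrite -(@lee_pmul2l _ n.+1%:R%:E) ?fin_numE // ?lte_fin // integral_exceeds_sum.
rewrite (integral_selected jj mq) // muleCA -integral_num_selected //.
rewrite muleC -integralZr_real //; last 2 first.
- by apply: measurable_funM => //; exact: measurable_fun_natr.
- by move=> w; rewrite mulr_ge0.
apply: le_integral_real => //.
- exact: (measurable_funM (mgap j) (mqm j)).
- by do 2!apply: measurable_funM => //; exact: measurable_fun_natr.
- by move=> w; rewrite mulrAC ler_wpM2r // mulrC.
Qed.

(** The loss of [1] in [gap_ge], weighted by [1 / kappa], is written as [F theta / F theta];
    [integral_selected] then exchanges the numerator for the selection of [j]. *)
Lemma exceeds_lower j :
  (alpha%:E * (n.+1%:R%:E *
   \int[P]_w ((selected j (z w) (inr j) : nat)%:R / (kappa (masked j (z w)))%:R)%:E) <=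
   n.+1%:R%:E *
   \int[P]_w ((exceeds j (z w) (inr j) : nat)%:R / (kappa (masked j (z w)))%:R)%:E +
   \int[P]_w ((selected j (z w) (inr j) : nat)%:R *
               ((kappa (masked j (z w)))%:R^-1 * (F (threshold j (z w)))^-1))%:E)%E.
Proof.
have /andP[/ltW alpha0 /ltW alpha1] := alpha01.
have jj : augmented j (inr j : index) by rewrite /= eqxx.
have mF : measurable_fun setT F := measurable_score_cdf (inr j).
have F0 t : 0 <= F t := score_cdf_ge0 (inr j) t.
have mFm : measurable_fun setT (F \o loo_threshold kappa j).
  by apply: measurableT_comp => //; exact: measurable_loo_threshold.
have mFt : measurable_fun setT (fun w => F (threshold j (z w))).
  by apply: measurableT_comp.
pose qi s := q s * (F (loo_threshold kappa j s))^-1.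
(* Where [F theta = 0], an event on which nothing is selected almost surely, the junk
   value [0^-1 = 0] kills the [qi] term; [qz] makes up for it. *)
pose qz s := q s * ((F (loo_threshold kappa j s) == 0) : nat)%:R.
have mqi : measurable_fun setT qi.
  by apply: measurable_funM => //; exact: measurable_fun_inv.
have mqz : measurable_fun setT qz.
  apply: measurable_funM => //; apply: measurable_fun_natr_bool.
  exact: measurable_fun_eqr.
have qi0 s : 0 <= qi s by rewrite mulr_ge0 // invr_ge0.
have qz0 s : 0 <= qz s by rewrite mulr_ge0.
have mqim : measurable_fun setT (fun w => qi (masked j (z w))).
  exact: measurableT_comp.
have mqzm : measurable_fun setT (fun w => qz (masked j (z w))).
  exact: measurableT_comp.
have mN : measurable_fun setT (fun w => (num_selected j (z w))%:R : R).
  exact: measurable_fun_natr.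
(* By [integral_num_selected] the integrand becomes a multiple of [F theta] times the indicator of
   [F theta = 0], which is identically zero. *)
have null : (\int[P]_w ((num_selected j (z w))%:R * qz (masked j (z w)))%:E = 0)%E.
  rewrite integral_num_selected // integral0_eq ?mule0 // => w _.
  congr EFin; rewrite /qz -/(threshold j (z w)).
  by case: eqP => [->|]; rewrite ?mul0r // mulr0 mulr0.
have mg1 : measurable_fun setT (fun w => (num_selected j (z w) -
    conf_index alpha (num_selected j (z w)))%:R * q (masked j (z w))).
  exact: measurable_funM.
have mg2 : measurable_fun setT (fun w => F (threshold j (z w)) * qi (masked j (z w))).
  exact: measurable_funM.
have mg3 : measurable_fun setT (fun w => (num_selected j (z w))%:R * qz (masked j (z w))).
  exact: measurable_funM.
rewrite (integral_selected jj mq) // -integral_num_selected //.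
rewrite integral_exceeds_sum (integral_selected jj mqi) //.
(* Adding this null integral on the right reduces the claim to a pointwise inequality. *)
rewrite -[leRHS]adde0 -null -integralD_real //; try by move=> w; rewrite mulr_ge0.
rewrite -integralD_real //; last 3 first.
- exact: measurable_funD.
- by move=> w; rewrite addr_ge0 // mulr_ge0.
- by move=> w; rewrite mulr_ge0.
rewrite muleC -integralZr_real //; last 2 first.
- exact: measurable_funM.
- by move=> w; rewrite mulr_ge0.
apply: le_integral_real => //.
- by apply: measurable_funM => //; exact: measurable_funM.
- by do 2!apply: measurable_funD => //.
- by move=> w; rewrite !mulr_ge0.
move=> w; rewrite /qi /qz -/(threshold j (z w)) -[(kappa _)%:R^-1]/(q (masked j (z w))).
set N := num_selected j (z w); set c := q _; set Ft := F _.
have c0 : 0 <= c by exact: q_ge0.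
case: (eqVneq Ft 0) => [->|Ft0].
  (* Where [F theta = 0], the added term is [N * c], and it dominates [alpha * N * c] because
     [alpha <= 1]. *)
  rewrite mul0r addr0 mulr1 -[leLHS]add0r lerD ?mulr_ge0 //.
  by rewrite ler_piMr // mulr_ge0.
(* Elsewhere the correction is exactly [c], and [gap_ge] multiplied by [c] is the claim. *)
rewrite (mulrCA Ft) mulfV // !(mulr1, mulr0) addr0 mulrAC.
by rewrite -[X in _ <= _ + X]mul1r -mulrDl ler_wpM2r // mulrC.
Qed.

End calibrated_selection.

Lemma measurable_ostat_tuple d (T : measurableType d) (R : realType) (m : nat)
    (s : T -> m.-tuple R) (k : T -> nat) :
  measurable_fun setT s -> measurable_fun setT k ->
  measurable_fun setT (fun w => ostat (s w) (k w)).
Proof.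
move=> ms mk; apply: (measurable_fun_natr_case (G := fun r w => ostat (s w) r)) => // r.
under eq_fun do rewrite -map_tnth_enum.
by apply: measurable_ostat => l; apply: (measurableT_comp (measurable_tnth l)).
Qed.

(** * From the false coverage proportion to leave-one-out exceedances *)

Section false_coverage.
Context (R : realType) (n m dim : nat) d (Omega : measurableType d).
Variables (X : 'I_n + 'I_m -> Omega -> dim.-tuple R)
  (Y : 'I_n + 'I_m -> Omega -> R) (muhat g : dim.-tuple R -> R)
  (kappa : m.-tuple R -> nat) (alpha t_u : R).
Hypothesis alpha1 : alpha < 1.
Local Notation score := (score X g).
Local Notation resid := (resid X Y muhat).
Local Notation sel_test := (sel_test X g kappa).
Local Notation sel_calib := (sel_calib X g kappa).
Local Notation Tord := (Tord X g).
Local Notation kappa_hat := (kappa_hat X g kappa).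
Local Notation miscovered := (miscovered X Y muhat g kappa alpha).
Local Notation fcp := (fcp X Y muhat g kappa alpha).

Lemma miscoveredE w j : miscovered w j =
  (conf_index alpha (size (sel_calib w)).+1 <=
   count (fun i => resid (inl i) w < resid (inr j) w)%R (sel_calib w))%N.
Proof.
rewrite /miscovered notin_symmetric_interval; last first.
  by rewrite /Qhat /qalpha; case: ifP.
by rewrite qalpha_lt // size_map count_map.
Qed.

Definition pair_of w a : R * R := (score a w, resid a w).

Section test_driven.
Variable w : Omega.
Local Notation z := (pair_of w).
Hypothesis kappa_masked :
  forall j, kappa (masked t_u j z) = kappa (tests z).
Hypothesis kappa_bnd : (1 <= kappa (tests z) <= m.-1)%N.

(** For a selected [j] the threshold is [T_(kappa+1)], so the selected group is [sel_calib] together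
    with [j]: its size is the successor found in [miscoveredE]. *)
Lemma exceeds_miscovered j : exceeds alpha t_u kappa j z (inr j) =
  selected t_u kappa j z (inr j) && miscovered w j.
Proof.
rewrite /exceeds /= eqxx /=; case: (boolP (selected _ _ _ _ _)) => //= selj.
have calibE i : selected t_u kappa j z (inl i) = (score (inl i) w <= Tord w (kappa_hat w).+1).
  by rewrite /selected -(ostat_threshold kappa_masked kappa_bnd selj).
rewrite miscoveredE /num_selected !card_augmented selj ltxx andbF addn1 addn0.
congr (conf_index alpha _.+1 <= _)%N.
  by rewrite size_filter count_enum; apply: eq_card => i; rewrite !inE calibE.
rewrite count_filter count_enum; apply: eq_card => i.
by rewrite !inE calibE andbC.
Qed.

Hypothesis score_inj : injective (fun l => (z (inr l)).1).

Lemma size_sel_test : size (sel_test w) = kappa (tests z).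
Proof.
rewrite -(card_selected_tests kappa_masked kappa_bnd score_inj).
rewrite size_filter count_enum; apply: eq_card => j.
by rewrite !inE (selected_test kappa_masked kappa_bnd).
Qed.

Lemma sum_selected :
  (\sum_(j < m) (selected t_u kappa j z (inr j) : nat))%N = kappa (tests z).
Proof.
rewrite -(card_selected_tests kappa_masked kappa_bnd score_inj).
by rewrite -sum1_card [RHS]big_mkcond; apply: eq_bigr => j _; rewrite inE; case: selected.
Qed.

(** Exactly [kappa] test points are selected, a positive number, so the [maxn] is inert. Writing the
    denominator with the masked vector makes each term a leave-one-out quantity. *)
Lemma fcpE : fcp w = \sum_(j < m) (exceeds alpha t_u kappa j z (inr j) : nat)%:R /
  (kappa (masked t_u j z))%:R.
Proof.
under eq_bigr do rewrite kappa_masked.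
rewrite -mulr_suml -natr_sum /fcp size_sel_test.
have /andP[/maxn_idPl -> _] := kappa_bnd; congr (_%:R / _).
rewrite count_filter count_enum -sum1_card big_mkcond; apply: eq_bigr => j _.
rewrite inE exceeds_miscovered andbC (selected_test kappa_masked kappa_bnd) /=.
by case: (_ && _).
Qed.

(** The [kappa] selected indices share the threshold [T_(kappa+1)] and have weight [1 / kappa] each.
    It serves with [c = 1] for the total mass and with [c = 1 / F] for the loss. *)
Lemma sum_selected_kappa (c : R -> R) :
  \sum_(j < m) (selected t_u kappa j z (inr j) : nat)%:R *
     ((kappa (masked t_u j z))%:R^-1 * c (threshold t_u kappa j z)) =
  c (Tord w (kappa_hat w).+1).
Proof.
rewrite (eq_bigr (fun j => (selected t_u kappa j z (inr j) : nat)%:R *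
    ((kappa (tests z))%:R^-1 * c (Tord w (kappa_hat w).+1)))); last first.
  move=> j _; rewrite kappa_masked.
  case: (boolP (selected _ _ _ _ _)) => [selj|]; last by rewrite !mul0r.
  by rewrite -(ostat_threshold kappa_masked kappa_bnd selj).
rewrite -mulr_suml -natr_sum sum_selected mulrA mulfV ?mul1r //.
by rewrite pnatr_eq0 -lt0n; case/andP: kappa_bnd.
Qed.

End test_driven.

Hypothesis mkappa : measurable_fun setT kappa.
Hypothesis mscore : forall a, measurable_fun setT (score a).
Hypothesis mresid : forall a, measurable_fun setT (resid a).

Lemma measurable_test_scores : measurable_fun setT (test_scores X g).
Proof.
apply/measurable_fun_tnthP => l; rewrite (_ : _ \o _ = score (inr l)) //.
by apply/funext => w; rewrite /= tnth_mktuple.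
Qed.

Lemma measurable_Tord (k : Omega -> nat) : measurable_fun setT k ->
  measurable_fun setT (fun w => Tord w (k w)).
Proof. by move=> mk; apply: measurable_ostat_tuple => //; exact: measurable_test_scores. Qed.

Lemma measurable_kappa_hat : measurable_fun setT kappa_hat.
Proof. exact: (measurableT_comp mkappa measurable_test_scores). Qed.

Lemma measurable_fcp : measurable_fun setT fcp.
Proof.
have mk := measurable_kappa_hat.
(* [fcp] is determined by the comparisons of the scores with the two thresholds and of calibration
   residuals with test residuals. *)
pose K := ('I_n + 'I_m + ('I_n * 'I_m))%type.
pose B (p : K) w := match p with
  | inl (inl i) => score (inl i) w <= Tord w (kappa_hat w).+1
  | inl (inr j) => score (inr j) w <= Tord w (kappa_hat w)
  | inr p => resid (inl p.1) w < resid (inr p.2) w end.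
pose calib (b : {ffun K -> bool}) := [seq i <- enum 'I_n | b (inl (inl i))].
pose mis (b : {ffun K -> bool}) j := (conf_index alpha (size (calib b)).+1 <=
  count (fun i => b (inr (i, j))) (calib b))%N.
pose test (b : {ffun K -> bool}) := [seq j <- enum 'I_m | b (inl (inr j))].
pose G b : R := (count (mis b) (test b))%:R / (maxn (size (test b)) 1)%:R.
rewrite (_ : fcp = (fun w => G [ffun p => B p w])).
  apply: measurable_fun_finite_bools => -[[i|j]|[i j]] /=.
  - apply: measurable_fun_ler => //; apply: measurable_Tord.
    exact: (measurableT_comp (f := succn)).
  - by apply: measurable_fun_ler => //; exact: measurable_Tord.
  - exact: measurable_fun_ltr.
apply/funext => w; rewrite /fcp /G.
have testE : test [ffun p => B p w] = sel_test w.
  by apply: eq_filter => j; rewrite ffunE.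
have calibE : calib [ffun p => B p w] = sel_calib w.
  by apply: eq_filter => i; rewrite ffunE.
rewrite testE; congr (_%:R / _); apply: eq_count => j.
rewrite miscoveredE /mis calibE; congr (_ <= _)%N; apply: eq_count => i.
by rewrite ffunE.
Qed.

End false_coverage.

(** * Summation over the test indices and the two bounds *)

Theorem theorem2 (R : realType) (d : measure_display) (Omega : measurableType d)
  (P : probability Omega R) (n m dim : nat)
  (X : 'I_n + 'I_m -> Omega -> dim.-tuple R) (Y : 'I_n + 'I_m -> Omega -> R)
  (muhat g : dim.-tuple R -> R) (alpha : R) (kappa : m.-tuple R -> nat)
  (F : R -> R) (t_u : R) :
  (2 <= m)%N ->
  0 < alpha < 1 ->
  measurable_fun [set: dim.-tuple R] muhat ->
  measurable_fun [set: dim.-tuple R] g ->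
  iid P (fun i w => (X i w, Y i w)) ->
  (forall i, continuous_rv P (score X g i)) ->
  (forall i, continuous_rv P (resid X Y muhat i)) ->
  measurable_fun [set: m.-tuple R] kappa ->
  (forall s, (1 <= kappa s <= m)%N) ->
  {ae P, forall w, forall j : 'I_m,
      kappa (replace_at (test_scores X g w) j t_u) = kappa (test_scores X g w)} ->
  {ae P, forall w, (kappa_hat X g kappa w <= m.-1)%N} ->
  (forall i t, (F t)%:E = P [set w | score X g i w <= t]) ->
  let FCR := (\int[P]_w (fcp X Y muhat g kappa alpha w)%:E)%E in
  ((alpha%:E - \int[P]_w ((n.+1%:R * F (Tord X g w (kappa_hat X g kappa w).+1))^-1)%:E
     <= FCR) /\ (FCR <= alpha%:E))%E.
Proof.
move=> m2 alpha01 mmu mg iidXY contT contR mkappa kappa_ge1 kappa_rep kappa_le FE FCR.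
have /andP[/ltW alpha0 alpha1] := alpha01.
have mpair : measurable_fun setT
    (fun v : dim.-tuple R * R => (g v.1, `|v.2 - muhat v.1|)).
  apply: measurable_fun_pair; first exact: measurableT_comp.
  apply: measurableT_comp => //; apply: measurable_funB => //.
  exact: measurableT_comp.
pose Z a w := pair_of X Y muhat g w a.
have iidZ : iid P Z := iid_comp mpair iidXY.
have [mZ _ _] := iidZ.
have mscore a : measurable_fun setT (score X g a).
  exact: (measurableT_comp measurable_fst (mZ a)).
have mresid a : measurable_fun setT (resid X Y muhat a).
  exact: (measurableT_comp measurable_snd (mZ a)).
have FZ a t : (F t)%:E = P [set w | (Z a w).1 <= t] := FE a t.
(* The facts on [F] are read off one score; [m >= 2] supplies a test index, whereas [n] may be
   [0]. *)
have mF : measurable_fun setT F.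
  exact: (measurable_score_cdf iidZ FZ (inr (Ordinal (ltnW m2)))).
have F0 t : 0 <= F t := score_cdf_ge0 FZ (inr (Ordinal (ltnW m2))) t.
(* The almost sure event on which the identities for a fixed sample hold. *)
pose good w := [/\ forall j, kappa (masked t_u j (Z ^~ w)) = kappa (tests (Z ^~ w)),
  (1 <= kappa (tests (Z ^~ w)) <= m.-1)%N & injective (fun l : 'I_m => (Z (inr l) w).1)].
have ae_good : {ae P, forall w, good w}.
  have iidT : iid P (fun a w => (Z a w).1) by exact: (iid_comp measurable_fst iidZ).
  apply: filterS3 kappa_rep kappa_le (iid_continuous_injective iidT contT) => w rep_w le_w inj_w.
  rewrite /good; split => //; last by move=> l l' /inj_w [].
  by have /andP[k_gt0 _] := kappa_ge1 (test_scores X g w); apply/andP; split.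
(* The exceedance, selection and loss terms of index [j], each weighted by [1 / kappa]; their sums
   over [j] are [FCR], [1] and [B]. *)
pose H j : \bar R := (\int[P]_w ((exceeds alpha t_u kappa j (Z ^~ w) (inr j) : nat)%:R /
  (kappa (masked t_u j (Z ^~ w)))%:R)%:E)%E.
pose S j : \bar R := (\int[P]_w ((selected t_u kappa j (Z ^~ w) (inr j) : nat)%:R /
  (kappa (masked t_u j (Z ^~ w)))%:R)%:E)%E.
pose G j : \bar R := (\int[P]_w ((selected t_u kappa j (Z ^~ w) (inr j) : nat)%:R *
  ((kappa (masked t_u j (Z ^~ w)))%:R^-1 * (F (threshold t_u kappa j (Z ^~ w)))^-1))%:E)%E.
have mk j : measurable_fun setT (fun w => (kappa (masked t_u j (Z ^~ w)))%:R^-1 : R).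
  apply: measurable_fun_inv; apply: measurable_fun_natr.
  by apply: (measurableT_comp mkappa); exact: measurable_masked.
have msel j : measurable_fun setT
    (fun w => (selected t_u kappa j (Z ^~ w) (inr j) : nat)%:R : R).
  by apply: measurable_fun_natr_bool; exact: measurable_selected.
have mex j : measurable_fun setT
    (fun w => (exceeds alpha t_u kappa j (Z ^~ w) (inr j) : nat)%:R : R).
  by apply: measurable_fun_natr_bool; exact: measurable_exceeds.
have mFt j : measurable_fun setT (fun w => (F (threshold t_u kappa j (Z ^~ w)))^-1).
  apply: measurable_fun_inv; apply: measurableT_comp => //.
  exact: measurable_threshold.
have mTord : measurable_fun setT
    (fun w => F (Tord X g w (kappa_hat X g kappa w).+1)).
  apply: measurableT_comp => //; apply: measurable_Tord => //.
  by apply: (measurableT_comp (f := succn)) => //; exact: measurable_kappa_hat.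
pose B : \bar R := (\int[P]_w ((F (Tord X g w (kappa_hat X g kappa w).+1))^-1)%:E)%E.
have sumH : (\sum_(j < m) H j)%E = FCR.
  rewrite -integral_fin_sum; last 2 first.
  - by move=> j; exact: measurable_funM.
  - by move=> j w; rewrite divr_ge0.
  apply: ae_eq_integral_real.
  - by apply: measurable_fin_sum => j; exact: measurable_funM.
  - exact: measurable_fcp.
  by apply: filterS ae_good => w [k1 k2 inj_w]; rewrite (fcpE alpha1 k1 k2 inj_w).
have sumS : (\sum_(j < m) S j)%E = 1%E.
  rewrite -integral_fin_sum; last 2 first.
  - by move=> j; exact: measurable_funM.
  - by move=> j w; rewrite divr_ge0.
  transitivity (\int[P]_w (1 : R)%:E)%E; last first.
    by rewrite integral_cst // mul1e; exact: probability_setT.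
  apply: ae_eq_integral_real => //.
  - by apply: measurable_fin_sum => j; exact: measurable_funM.
  apply: filterS ae_good => w [k1 k2 inj_w].
  rewrite -[RHS](sum_selected_kappa k1 k2 inj_w (fun=> 1)).
  by apply: eq_bigr => j _; rewrite mulr1.
have sumG : (\sum_(j < m) G j)%E = B.
  rewrite -integral_fin_sum; last 2 first.
  - by move=> j; do 2!apply: measurable_funM => //.
  - by move=> j w; rewrite mulr_ge0 // mulr_ge0 ?invr_ge0.
  apply: ae_eq_integral_real.
  - by apply: measurable_fin_sum => j; do 2!apply: measurable_funM => //.
  - exact: measurable_fun_inv.
  apply: filterS ae_good => w [k1 k2 inj_w].
  by rewrite (sum_selected_kappa k1 k2 inj_w (fun t => (F t)^-1)).
have H0 j : (0 <= H j)%E.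
  by apply: integral_ge0 => w _; rewrite lee_fin divr_ge0.
have S0 j : (0 <= S j)%E.
  by apply: integral_ge0 => w _; rewrite lee_fin divr_ge0.
have B0 : (0 <= B)%E.
  by apply: integral_ge0 => w _; rewrite lee_fin invr_ge0.
have FCR0 : (0 <= FCR)%E by rewrite -sumH; apply: sume_ge0.
split; last first.
  rewrite -sumH -[leRHS]mule1 -sumS ge0_sume_distrr //.
  by apply: lee_sum => j _; exact: exceeds_upper.
(* The sum of [exceeds_lower] over [j], still scaled by [n + 1]. *)
have lower : (alpha%:E * n.+1%:R%:E <= n.+1%:R%:E * FCR + B)%E.
  rewrite -[leLHS]mule1 -sumS -muleA -sumH -sumG !ge0_sume_distrr //; last first.
    by move=> j _; rewrite mule_ge0 // lee_fin.
  by rewrite -big_split; apply: lee_sum => j _; exact: exceeds_lower.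
have BE : (\int[P]_w ((n.+1%:R * F (Tord X g w (kappa_hat X g kappa w).+1))^-1)%:E =
    B * (n.+1%:R^-1)%:E)%E.
  rewrite -integralZr_real; last 3 first.
  - exact: measurable_fun_inv.
  - by move=> w; rewrite invr_ge0.
  - by rewrite invr_ge0.
  by apply: eq_integral => w _; rewrite invfM mulrC.
rewrite BE; set A := (B * _)%E.
have A0 : (0 <= A)%E by rewrite mule_ge0 // lee_fin invr_ge0.
have AE : (n.+1%:R%:E * A = B)%E.
  by rewrite /A muleCA -EFinM mulfV ?mule1 // pnatr_eq0.
(* The expectation [A] may be [+oo]; the lower bound is then [-oo] and holds trivially. *)
suff : (alpha%:E <= FCR + A)%E.
  case: A A0 {AE} => [r| |] // _; first by rewrite leeBlDr.
  by move=> _; rewrite leNye.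
rewrite -(@lee_pmul2l _ n.+1%:R%:E) // ?lte_fin // ge0_muleDr // AE muleC.
exact: lower.
Qed.
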